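(* Let $(\mathfrak{M}, \rho, \mathbb{Z}, \Xi)$ be a W*-dynamical system, and let $(\mathfrak{A}, \mathbb{Z}, \Theta; \iota)$ be a faithful C*-model of $(\mathfrak{M}, \rho, \mathbb{Z}, \Xi)$. Consider the following conditions. (i) The C*-dynamical system $(\mathfrak{A}, \mathbb{Z}, \Theta)$ is uniquely ergodic. (ii) The C*-dynamical system $(\mathfrak{A}, \mathbb{Z}, \Theta)$ is strictly ergodic. (iii) $\Gamma(\iota(a)) = \rho(\iota(a))$ for all positive $a \in \mathfrak{A}$. Then (i) and (ii) are equivalent, and (i) implies (iii). Further, if $\mathcal{S}^{\mathbb{Z}}$ is a simplex, then (iii) implies (i).
   Context: A C*-dynamical system $(\mathfrak{A}, \mathbb{Z}, \Theta)$ consists of a unital C*-algebra $\mathfrak{A}$ and an action $\Theta$ of $\mathbb{Z}$ on $\mathfrak{A}$ by *-automorphisms. $\mathcal{S}^{\mathbb{Z}}$ is the set of $\Theta$-invariant states of $\mathfrak{A}$ with the weak*-topology. The system is uniquely ergodic if $\mathcal{S}^{\mathbb{Z}}$ is a singleton, and strictly ergodic if it is uniquely ergodic and its unique invariant state is faithful. A W*-dynamical system $(\mathfrak{M}, \rho, \mathbb{Z}, \Xi)$ consists of a von Neumann algebra $\mathfrak{M}$, a faithful normal tracial state $\rho$ on $\mathfrak{M}$, and an action $\Xi$ of $\mathbb{Z}$ on $\mathfrak{M}$ by $\rho$-preserving *-automorphisms. A C*-model $(\mathfrak{A}, \mathbb{Z}, \Theta; \iota)$ of it consists of a C*-dynamical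 system $(\mathfrak{A}, \mathbb{Z}, \Theta)$ and a *-homomorphism $\iota : \mathfrak{A} \to \mathfrak{M}$ such that $\iota(\mathfrak{A})$ is dense in $\mathfrak{M}$ in the weak operator topology, $\Xi_n(\iota(\mathfrak{A})) = \iota(\mathfrak{A})$ and $\Xi_n \circ \iota = \iota \circ \Theta_n$ for all $n \in \mathbb{Z}$. It is faithful if $\iota$ is injective. For a positive $b \in \mathfrak{M}$ the gauge is $\Gamma(b) = \lim_{k \to \infty} \frac{1}{k} \left\| \sum_{j=0}^{k-1} \Xi_j b \right\|$ (the limit exists by subadditivity). A compact subset $K$ of a locally convex real topological vector space $V$, contained in a hyperplane not containing the origin, is a simplex if the cone $P = \{ck : c \geq 0, k \in K\}$ defines a lattice ordering on $P - P$ via $a \leq b \iff b - a \in P$. Here $V$ is the space of self-adjoint bounded linear functionals on $\mathfrak{A}$ with the weak*-topology. *)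

(* Defs.v *)
From HB Require Import structures.
From mathcomp Require Import all_boot all_order all_algebra.
From mathcomp Require Import complex.
From mathcomp Require Import all_classical all_reals.
From mathcomp Require Import interval_inference convex topology normedtype sequences.

Set Implicit Arguments.
Unset Strict Implicit.
Unset Printing Implicit Defensive.

Import Order.TTheory GRing.Theory Num.Theory.
Import numFieldNormedType.Exports.

Local Open Scope classical_set_scope.
Local Open Scope ring_scope.
Local Open Scope complex_scope.

(* The library only equips abstract numeric fields with their normed topology. *)
HB.instance Definition _ (R : realType) := NormedModule.copy R[i] R[i]^o.

(* The norm is a field of the mixin, with values in [R], because the normed
   modules and the (semi)rings of the library have no common join. *)
HB.mixin Record isCStarAlgebra (R : realType) A of GRing.Algebra R[i] A := {
  star : A -> A;
  cnorm : A -> R;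
  starD : forall x y : A, star (x + y) = star x + star y;
  starZ : forall (c : R[i]) (x : A), star (c *: x) = (c^*)%R *: star x;
  starM : forall x y : A, star (x * y) = star y * star x;
  starK : forall x : A, star (star x) = x;
  cnorm_eq0 : forall x : A, cnorm x = 0 -> x = 0;
  cnormZ : forall (c : R[i]) (x : A), (cnorm (c *: x))%:C = `|c| * (cnorm x)%:C;
  cnormD : forall x y : A, cnorm (x + y) <= cnorm x + cnorm y;
  cnormM : forall x y : A, cnorm (x * y) <= cnorm x * cnorm y;
  cnorm_starM : forall x : A, cnorm (star x * x) = cnorm x ^+ 2;
  cnorm_complete : forall u : nat -> A,
    (forall e : R, 0 < e -> exists N : nat, forall m n : nat,
       (N <= m)%N -> (N <= n)%N -> cnorm (u m - u n) < e) ->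
    exists l : A, (fun n => cnorm (u n - l)) @ \oo --> (0 : R)
}.

#[short(type="cstarAlgType")]
HB.structure Definition CStarAlgebra (R : realType) :=
  {A of GRing.Algebra R[i] A & isCStarAlgebra R A}.

Section SelfAdjointDual.
Variables (R : realType) (A : cstarAlgType R).

Definition sa_functional (f : A -> R[i]) : Prop :=
  [/\ forall (c : R[i]) (a b : A), f (c *: a + b) = c * f a + f b,
      exists K : R, forall a, `|f a| <= (K * cnorm a)%:C &
      forall a, f (star a) = ((f a)^*)%R].

Record sa_dual := SADual {
  sa_fun :> A -> R[i];
  sa_funP : `[< sa_functional sa_fun >] }.

HB.instance Definition _ := [isSub for sa_fun].
HB.instance Definition _ := [Choice of sa_dual by <:].

Lemma sa_dualP (f : sa_dual) : sa_functional f.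
Proof. exact/asboolP/(sa_funP f). Qed.

Lemma sa_dual_ext (f g : sa_dual) : (forall a, f a = g a) -> f = g.
Proof. by move=> fg; apply/val_inj/funext. Qed.

Fact sa_zero_subproof : sa_functional (fun _ => 0).
Proof.
split=> [c a b||a]; first by rewrite mulr0 addr0.
  by exists 0 => a; rewrite normr0 mul0r.
by rewrite conjC0.
Qed.

Fact sa_add_subproof (f g : sa_dual) : sa_functional (fun a => f a + g a).
Proof.
case: (sa_dualP f) (sa_dualP g) => fl [K fK] fs [gl [L gL] gs].
split=> [c a b||a]; first by rewrite fl gl mulrDr addrACA.
  exists (K + L) => a; rewrite mulrDl rmorphD /=.
  by rewrite (le_trans (ler_normD _ _))// lerD.
by rewrite fs gs rmorphD.
Qed.

Fact sa_scale_subproof (r : R) (f : sa_dual) :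
  sa_functional (fun a => r%:C * f a).
Proof.
have [fl [K fK] fs] := sa_dualP f; split=> [c a b||a].
- by rewrite fl mulrDr mulrCA.
- exists (`|r| * K) => a; rewrite -mulrA rmorphM /= normrM.
  by rewrite normc_def /= expr0n addr0 sqrtr_sqr ler_wpM2l// ler0c.
- by rewrite fs rmorphM /=; congr (_ * _); rewrite conj_Creal// complex_real.
Qed.

Definition sa_mk f (Pf : sa_functional f) : sa_dual := SADual (introT (asboolP _) Pf).
Definition sa_zero := sa_mk sa_zero_subproof.
Definition sa_add f g := sa_mk (sa_add_subproof f g).
Definition sa_scale r f := sa_mk (sa_scale_subproof r f).

Fact sa_addA : associative sa_add.
Proof. by move=> f g h; apply/sa_dual_ext => a /=; rewrite addrA. Qed.
Fact sa_addC : commutative sa_add.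
Proof. by move=> f g; apply/sa_dual_ext => a /=; rewrite addrC. Qed.
Fact sa_add0 : left_id sa_zero sa_add.
Proof. by move=> f; apply/sa_dual_ext => a /=; rewrite add0r. Qed.
Fact sa_addN : left_inverse sa_zero (sa_scale (-1)) sa_add.
Proof.
by move=> f; apply/sa_dual_ext => a /=; rewrite rmorphN1 mulN1r addNr.
Qed.
HB.instance Definition _ :=
  GRing.isZmodule.Build sa_dual sa_addA sa_addC sa_add0 sa_addN.

Fact sa_scaleA a b f : sa_scale a (sa_scale b f) = sa_scale (a * b) f.
Proof. by apply/sa_dual_ext => x /=; rewrite mulrA -rmorphM. Qed.
Fact sa_scale1 : left_id 1 sa_scale.
Proof. by move=> f; apply/sa_dual_ext => x /=; rewrite mul1r. Qed.
Fact sa_scaleDr : right_distributive sa_scale +%R.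
Proof. by move=> r f g; apply/sa_dual_ext => x /=; rewrite mulrDr. Qed.
Fact sa_scaleDl f : {morph sa_scale^~ f : a b / a + b}.
Proof. by move=> r s; apply/sa_dual_ext => x /=; rewrite rmorphD mulrDl. Qed.
HB.instance Definition _ := GRing.Zmodule_isLmodule.Build R sa_dual
  sa_scaleA sa_scale1 sa_scaleDr sa_scaleDl.

Definition sa_eval (f : sa_dual) : {ptws A -> R[i]} := f.

HB.instance Definition _ := Topological.copy sa_dual (initial_topology sa_eval).

Lemma sa_dual_cvgP (F : set_system sa_dual) (f : sa_dual) : Filter F ->
  F --> f <-> forall a, (fun g : sa_dual => g a) @ F --> f a.
Proof.
move=> FF; split=> [Ff a U Ua|Ff].
  have /cvg_sup/(_ a) ev_a : nbhs (sa_eval f) --> sa_eval f by exact: cvg_id.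
  pose ev (h : {ptws A -> R[i]}) := h a.
  have /ev_a nU := @initial_continuous _ _ ev (sa_eval f) _ Ua.
  exact/Ff/(@initial_continuous _ _ (@sa_eval) f _ nU).
have {}Ff : sa_eval @ F --> sa_eval f.
  apply/cvg_sup => a U; rewrite nbhsE => -[_ [[O oO <-] Of] OU].
  by apply: filterS OU _; apply: Ff; exact: open_nbhs_nbhs.
move=> U; rewrite nbhsE => -[_ [[O oO <-] Of] OU]; apply: filterS OU _.
exact/Ff/open_nbhs_nbhs.
Qed.

Lemma sa_dual_eval_continuous a : continuous (fun f : sa_dual => f a).
Proof.
by move=> f; apply: ((sa_dual_cvgP f (nbhs_filter f)).1 cvg_id).
Qed.

Fact sa_add_continuous : continuous (fun x : sa_dual * sa_dual => x.1 + x.2).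
Proof.
move=> [f g]; apply/sa_dual_cvgP => a.
have cf : (fun x : sa_dual * sa_dual => x.1 a) @ (f, g) --> f a.
  exact: cvg_comp (@cvg_fst _ _ (nbhs f) (nbhs g) _) (@sa_dual_eval_continuous a f).
have cg : (fun x : sa_dual * sa_dual => x.2 a) @ (f, g) --> g a.
  exact: cvg_comp (@cvg_snd _ _ (nbhs f) (nbhs g) _) (@sa_dual_eval_continuous a g).
exact: cvgD cf cg.
Qed.

Lemma real_complex_continuous : continuous (fun r : R^o => r%:C).
Proof.
move=> r; apply/cvgrPdist_lt => e e0.
have [er ei] : 0 < complex.Re e /\ e = (complex.Re e)%:C.
  by case: e e0 => x y; rewrite ltcE /= => /andP[/eqP -> ->].
near=> s; rewrite -rmorphB /= normc_def /= expr0n addr0 sqrtr_sqr ei ltcR.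
by near: s; exact: cvgr_dist_lt.
Unshelve. all: by end_near. Qed.

Fact sa_scale_continuous : continuous (fun z : R^o * sa_dual => z.1 *: z.2).
Proof.
move=> [r f]; apply/sa_dual_cvgP => a.
have cr : (fun x : R^o * sa_dual => x.1%:C) @ (r, f) --> r%:C.
  exact: cvg_comp (@cvg_fst _ _ (nbhs (r : R^o)) (nbhs f) _) (@real_complex_continuous r).
have cf : (fun x : R^o * sa_dual => x.2 a) @ (r, f) --> f a.
  exact: cvg_comp (@cvg_snd _ _ (nbhs (r : R^o)) (nbhs f) _) (@sa_dual_eval_continuous a f).
exact: cvgM cr cf.
Qed.

Fact sa_locally_convex : exists2 B : set_system sa_dual,
  (forall b, b \in B -> convex_set b) & basis B.
Proof.
exists [set U | open U /\ convex_set U]; first by move=> b /set_mem[].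
split=> [U []//|f].
have FF : Filter (filter_from [set U : set sa_dual |
    (open U /\ convex_set U) /\ U f] id).
  apply: filter_from_filter.
    by exists setT; split=> //; split; [exact: openT|move=> *; exact: in_setT].
  move=> U V [[oU cU] Uf] [[oV cV] Vf]; exists (U `&` V) => //.
  split=> //; split; first exact: openI.
  move=> x y l; rewrite !in_setI => /andP[xU xV] /andP[yU yV].
  by rewrite cU// cV.
apply/sa_dual_cvgP => a; apply/cvgrPdist_lt => e e0.
exists [set g : sa_dual | `|f a - g a| < e]; last by [].
split; last by rewrite /= subrr normr0.
split.
  have := @open_comp _ _ (fun g : sa_dual => g a) (ball (f a) e).
  rewrite -ball_normE; apply; last exact: ball_open.
  by move=> g _; exact: sa_dual_eval_continuous.
apply/convex_setW => g h; rewrite !inE /= => ge he l l0 l1.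
set s : R := l%:num; have t0 : 0 < 1 - s by rewrite subr_gt0.
rewrite inE /= (_ : f a - _ = s%:C * (f a - g a) + (1 - s)%:C * (f a - h a)).
  have sC : 0 < s%:C by rewrite (ltcR 0).
  have tC : 0 < (1 - s)%:C by rewrite (ltcR 0).
  rewrite (le_lt_trans (ler_normD _ _))// !normrM (gtr0_norm sC) (gtr0_norm tC).
  have -> : e = s%:C * e + (1 - s)%:C * e by rewrite -mulrDl -rmorphD subrKC mul1r.
  by rewrite ltrD// ltr_pM2l.
rewrite !mulrBr addrACA -mulrDl -rmorphD subrKC mul1r; congr (_ + _).
by rewrite -opprD.
Qed.

(* The factory only builds the uniform structure of a tvs. *)
HB.instance Definition _ := PreTopologicalLmod_isTvs.Build R sa_dual
  sa_add_continuous sa_scale_continuous sa_locally_convex.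
HB.instance Definition _ :=
  PreTopologicalNmodule_isTopologicalNmodule.Build sa_dual sa_add_continuous.
HB.instance Definition _ :=
  TopologicalNmodule_isTopologicalLmodule.Build R sa_dual sa_scale_continuous.
HB.instance Definition _ := Uniform_isTvs.Build R sa_dual sa_locally_convex.

End SelfAdjointDual.

Section Simplex.
Variables (R : realType) (V : tvsType R).
Implicit Types (K P D : set V) (le : V -> V -> Prop).

Definition cone_over K : set V :=
  [set v | exists (c : R) (k : V), [/\ 0 <= c, K k & v = c *: k]].

Definition cone_span P : set V :=
  [set v | exists p q : V, [/\ P p, P q & v = p - q]].

Definition cone_le P (a b : V) : Prop := P (b - a).

Definition is_lub_in D le (x y s : V) : Prop :=
  [/\ D s, le x s, le y s & forall z, D z -> le x z -> le y z -> le s z].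

Definition lattice_order_on D le : Prop :=
  [/\ forall x, D x -> le x x,
      forall x y, D x -> D y -> le x y -> le y x -> x = y,
      forall x y z, D x -> D y -> D z -> le x y -> le y z -> le x z,
      forall x y, D x -> D y -> exists s, is_lub_in D le x y s &
      forall x y, D x -> D y -> exists s, is_lub_in D (fun a b => le b a) x y s].

Definition in_hyperplane_off_origin K : Prop :=
  exists (l : {scalar V}) (c : R),
    [/\ exists v, l v != 0, c != 0 & forall k, K k -> l k = c].

Definition is_simplex K : Prop :=
  [/\ compact K, in_hyperplane_off_origin K &
      lattice_order_on (cone_span (cone_over K)) (cone_le (cone_over K))].

End Simplex.

Definition Zaction_on (T : Type) (D : set T) (F : int -> T -> T) : Prop :=
  (forall x, D x -> F 0 x = x) /\
  (forall m n x, D x -> F (m + n) x = F m (F n x)).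

Section CStarSystems.
Variables (R : realType) (A : cstarAlgType R).

(* Positive elements are the squares b^* b, equivalently the self-adjoint
   elements with nonnegative spectrum. *)
Definition cpositive (a : A) : Prop := exists b : A, a = star b * b.

Definition cstar_aut (f : A -> A) : Prop :=
  [/\ bijective f, linear f, forall a b, f (a * b) = f a * f b &
      forall a, f (star a) = star (f a)].

Definition cstar_system (Theta : int -> A -> A) : Prop :=
  Zaction_on setT Theta /\ forall n, cstar_aut (Theta n).

Definition is_state (f : sa_dual A) : Prop :=
  (forall a, cpositive a -> 0 <= f a) /\ f 1 = 1.

Definition faithful_state (f : sa_dual A) : Prop :=
  forall a, cpositive a -> f a = 0 -> a = 0.

Definition invariant_states (Theta : int -> A -> A) : set (sa_dual A) :=
  [set f | is_state f /\ forall n a, f (Theta n a) = f a].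

Definition uniquely_ergodic (Theta : int -> A -> A) : Prop :=
  exists f, invariant_states Theta = [set f].

Definition strictly_ergodic (Theta : int -> A -> A) : Prop :=
  exists f, invariant_states Theta = [set f] /\ faithful_state f.

End CStarSystems.

(* The inner product is linear in its first argument. *)
HB.mixin Record isHilbert (R : realType) H of CompleteNormedModule R[i] H := {
  inner : H -> H -> R[i];
  innerPl : forall (c : R[i]) (x y z : H),
    inner (c *: x + y) z = c * inner x z + inner y z;
  innerC : forall x y : H, inner x y = ((inner y x)^*)%R;
  inner_norm : forall x : H, inner x x = `|x| ^+ 2
}.

#[short(type="hilbertType")]
HB.structure Definition Hilbert (R : realType) :=
  {H of CompleteNormedModule R[i] H & isHilbert R H}.

Section VonNeumann.
Variables (R : realType) (H : hilbertType R).
Implicit Types (S T : H -> H) (M : set (H -> H)).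

Definition bounded_op T : Prop := linear T /\ continuous T.

Definition is_adjoint T S : Prop := forall x y, inner (T x) y = inner x (S y).

Definition opnorm T : R :=
  sup [set r : R | exists2 x : H, `|x| <= 1 & r%:C = `|T x|].

Definition positive_op T : Prop := forall x, 0 <= inner (T x) x.

Definition wot_eval T : {ptws (H * H)%type -> R[i]} :=
  fun p => inner (T p.1) p.2.

Definition wot_closure M : set (H -> H) :=
  closure (M : set (initial_topology wot_eval)).

(* A von Neumann algebra is concrete: a unital *-algebra of bounded operators
   on H, given as a set of functions, closed in B(H) for the weak operator
   topology. *)
Record von_neumann_algebra M : Prop := {
  vN_bounded : forall T, M T -> bounded_op T;
  vN_id : M id;
  vN_add : forall S T, M S -> M T -> M (S + T);
  vN_scale : forall (c : R[i]) T, M T -> M (c *: T);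
  vN_comp : forall S T, M S -> M T -> M (S \o T);
  vN_adjoint : forall T, M T -> exists2 S, M S & is_adjoint T S;
  vN_closed : forall T, bounded_op T -> wot_closure M T -> M T
}.

Definition is_op_lub M (D : set (H -> H)) T : Prop :=
  [/\ M T, forall S, D S -> positive_op (T - S) &
      forall T', M T' -> (forall S, D S -> positive_op (T' - S)) ->
        positive_op (T' - T)].

Definition directed_op (D : set (H -> H)) : Prop :=
  forall S T, D S -> D T ->
    exists2 U, D U & positive_op (U - S) /\ positive_op (U - T).

Record faithful_normal_tracial_state M (rho : (H -> H) -> R[i]) : Prop := {
  tr_linear : forall (c : R[i]) S T, M S -> M T ->
    rho (c *: S + T) = c * rho S + rho T;
  tr_positive : forall T, M T -> positive_op T -> 0 <= rho T;
  tr_unit : rho id = 1;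
  tr_tracial : forall S T, M S -> M T -> rho (S \o T) = rho (T \o S);
  tr_faithful : forall T, M T -> positive_op T -> rho T = 0 -> T = 0;
  (* normality: rho (sup D) = sup (rho D) for bounded increasing families *)
  tr_normal : forall (D : set (H -> H)) T,
    D !=set0 -> (forall S, D S -> M S /\ positive_op S) -> directed_op D ->
    is_op_lub M D T ->
    forall c : R[i], (forall S, D S -> rho S <= c) -> rho T <= c
}.

(* Only the values of f on M matter. *)
Definition vN_aut M (f : (H -> H) -> (H -> H)) : Prop :=
  [/\ set_bij M M f,
      forall (c : R[i]) S T, M S -> M T -> f (c *: S + T) = c *: f S + f T,
      forall S T, M S -> M T -> f (S \o T) = f S \o f T &
      forall S T, M S -> M T -> is_adjoint S T -> is_adjoint (f S) (f T)].

Record wstar_system M (rho : (H -> H) -> R[i])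
    (Xi : int -> (H -> H) -> (H -> H)) : Prop := {
  ws_vN : von_neumann_algebra M;
  ws_trace : faithful_normal_tracial_state M rho;
  ws_action : Zaction_on M Xi;
  ws_aut : forall n, vN_aut M (Xi n);
  ws_preserving : forall n T, M T -> rho (Xi n T) = rho T
}.

Definition gauge (Xi : int -> (H -> H) -> (H -> H)) T : R :=
  lim ((fun k : nat => k%:R^-1 * opnorm (\sum_(j < k) Xi j%:Z T)) @ \oo).

(* iota is not assumed unital: iota 1 = id follows from the density of the range. *)
Record cstar_model M (Xi : int -> (H -> H) -> (H -> H))
    (A : cstarAlgType R) (Theta : int -> A -> A) (iota : A -> H -> H) : Prop := {
  cm_system : cstar_system Theta;
  cm_range : forall a, M (iota a);
  cm_linear : linear iota;
  cm_mul : forall a b, iota (a * b) = iota a \o iota b;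
  cm_star : forall a, is_adjoint (iota a) (iota (star a));
  cm_dense : M `<=` wot_closure (range iota);
  cm_invariant : forall n, Xi n @` range iota = range iota;
  cm_equivariant : forall n a, Xi n (iota a) = iota (Theta n a)
}.

End VonNeumann.

(* Main.v *)
Require Import Defs.
From mathcomp Require Import all_boot all_order all_algebra.
From mathcomp Require Import complex.
From mathcomp Require Import all_classical all_reals.
From mathcomp Require Import topology normedtype sequences.
From mathcomp Require Import ring lra.

(** The key fact is that the gauge is a maximum over invariant states:
    for positive [a], the gauge of [iota a] equals the largest value [phi a]
    of an invariant state [phi] of [A] ([gauge_is_max]).  The theorem follows
    by comparing all invariant states with [rho \o iota], which is one of
    them, and which is faithful because [rho] is faithful and [iota] is
    injective.  If the invariant state is unique, it is [rho \o iota]: this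
    gives strict ergodicity, and the maximum defining the gauge is the trace.
    Conversely, if the gauge is the trace then every invariant state is at
    most [rho \o iota] on positive elements; two positive functionals so
    ordered, with the same value at the unit, coincide ([pf_eq]).

    Write [s_k] for [k^-1] times the operator norm of the sum of the first
    [k] translates of [iota a].  Two estimates give the maximum.

    Every invariant state is at most [s_k], for all [k > 0]
    ([invariant_le_gauge_seq]).  A state of [A] sees the order of [A] whereas
    [s_k] is a norm of operators, so this needs an injective representation
    to reflect positivity ([positive_reflect]): if [iota b >= 0], compare [b]
    with its absolute value [d]; their images are commuting positive operators
    with the same square, hence are equal, so [b = d].  Absolute values come
    from the square root of [1 - b] for self-adjoint [b] in the unit ball
    ([sqrt_one_minus]), which is the limit of an explicit iteration, so that
    no spectral theory is involved.

    In the other direction, choose unit vectors that nearly attain the norms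
    in [s_k], and average the corresponding vector states over the first [k]
    translates.  Along any free ultrafilter these averages converge to an
    invariant state [phi], as in the Krylov-Bogoliubov theorem
    ([invariant_state_limit]), and [s_k] tends to [phi a]
    ([gauge_seq_ultralimit]).  By the first estimate, the limits along any two
    free ultrafilters bound each other; so they are all equal, [s_k]
    converges, and its limit is attained. *)

Set Implicit Arguments.
Unset Strict Implicit.
Unset Printing Implicit Defensive.

Import Order.TTheory GRing.Theory Num.Theory.
Import numFieldNormedType.Exports.

Local Open Scope classical_set_scope.
Local Open Scope ring_scope.
Local Open Scope complex_scope.

(** * Norm and square roots in a C*-algebra *)

Section CStarNorm.
Variables (R : realType) (A : cstarAlgType R).
Implicit Types (a b x y z : A).

Lemma normc_real (r : R) : `|r%:C| = `|r|%:C.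
Proof. by rewrite normc_def /= expr0n addr0 sqrtr_sqr. Qed.

Lemma conjc_def (z : R[i]) : (z^*)%R = (complex.Re z -i* complex.Im z).
Proof. by case: z. Qed.

Lemma conj_real_complex (r : R) : ((r%:C)^*)%R = r%:C.
Proof. by rewrite conjc_def /= oppr0. Qed.

Lemma cnormZr (r : R) x : cnorm (r%:C *: x) = `|r| * cnorm x.
Proof. by apply: complexI; rewrite cnormZ normc_real -rmorphM. Qed.

Lemma cnorm0 : cnorm (0 : A) = 0.
Proof. by rewrite -(scale0r (0 : A)) -[0 : R[i]]/(0%:C) cnormZr normr0 mul0r. Qed.

Lemma cnormN x : cnorm (- x) = cnorm x.
Proof.
have -> : - x = (-1)%:C *: x by rewrite rmorphN1 scaleN1r.
by rewrite cnormZr normrN1 mul1r.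
Qed.

Lemma cnorm_ge0 x : 0 <= cnorm x.
Proof.
have := cnormD x (- x); rewrite subrr cnorm0 cnormN => h.
by lra.
Qed.

Lemma cnormB x y : cnorm (x - y) <= cnorm x + cnorm y.
Proof. by rewrite -(cnormN y); exact: cnormD. Qed.

Lemma cnorm_distC x y : cnorm (x - y) = cnorm (y - x).
Proof. by rewrite -opprB cnormN. Qed.

Lemma half_add_half : (2^-1)%:C + (2^-1)%:C = 1 :> R[i].
Proof. by rewrite -rmorphD /= -[X in X + X]mul1r -splitr. Qed.

Lemma cnorm_half x : cnorm ((2^-1)%:C *: x) = cnorm x / 2.
Proof. by rewrite cnormZr ger0_norm ?invr_ge0// mulrC. Qed.

Lemma cnorm_star x : cnorm (star x) = cnorm x.
Proof.
suff h y : cnorm y <= cnorm (star y).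
  by apply/eqP; rewrite eq_le h andbT -{2}(starK x) h.
have [->|/eqP y0] := eqVneq (cnorm y) 0; first exact: cnorm_ge0.
have {}y0 : 0 < cnorm y by rewrite lt_def cnorm_ge0 andbT; exact/eqP.
by rewrite -(ler_pM2r y0) -expr2 -cnorm_starM cnormM.
Qed.

Lemma star0 : star (0 : A) = 0.
Proof. by rewrite -[X in star X](scale0r (0 : A)) starZ conjC0 scale0r. Qed.

Lemma starN x : star (- x) = - star x.
Proof. by rewrite -scaleN1r starZ rmorphN1 scaleN1r. Qed.

Lemma starB x y : star (x - y) = star x - star y.
Proof. by rewrite starD starN. Qed.

Lemma starZr (r : R) x : star (r%:C *: x) = r%:C *: star x.
Proof. by rewrite starZ conj_real_complex. Qed.

Lemma star1 : star (1 : A) = 1.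
Proof. by rewrite -[LHS]mul1r -{1}(starK 1) -starM mul1r starK. Qed.

Lemma cnorm1_le1 : cnorm (1 : A) <= 1.
Proof.
have := cnorm_starM (1 : A); rewrite star1 mul1r => h.
have := cnorm_ge0 1; nra.
Qed.

Lemma cnorm_sqr_sa x : star x = x -> cnorm (x * x) = cnorm x ^+ 2.
Proof. by move=> {1}<-; exact: cnorm_starM. Qed.

(** Identities between limits in [A] are obtained by bounding the norm of the
    difference of the two sides, since [cnorm] comes with no topology. *)
Lemma cnorm_small_eq0 (e : nat -> R) (K : R) x :
  e @ \oo --> 0 -> (forall n, cnorm x <= K * e n) -> x = 0.
Proof.
move=> e0 h; apply/cnorm_eq0/eqP; rewrite eq_le cnorm_ge0 andbT.
have K0 : (fun n => K * e n) @ \oo --> K * 0 by exact: cvgMr.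
rewrite mulr0 in K0.
have -> : 0 = lim ((fun n => K * e n) @ \oo) by apply/esym/cvg_lim.
by apply: limr_ge; [exact: cvgP K0|near=> n; exact: h].
Unshelve. all: by end_near. Qed.

Lemma sub_sqr x y : x * x - y * y = x * (x - y) + (x - y) * y.
Proof. by rewrite mulrBr mulrBl addrA subrK. Qed.

(** The iteration [sqrt_iter] for [b = 1]: it increases to a limit, and
    dominates [sqrt_iter b] as soon as [cnorm b <= 1]. *)
Fixpoint majorant (n : nat) : R :=
  if n is m.+1 then (1 + majorant m ^+ 2) / 2 else 0.

Lemma majorant01 n : 0 <= majorant n <= 1.
Proof. by elim: n => [|n /andP[h0 h1]] /=; rewrite ?lexx ?ler01//; nra. Qed.

Lemma majorant_incr n : majorant n <= majorant n.+1.
Proof.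
elim: n => [|n IH]; first by have /andP[] := majorant01 1.
rewrite [leLHS]/= [leRHS]/= -/(majorant n.+1).
have /andP[h0 h1] := majorant01 n; have /andP[h2 h3] := majorant01 n.+1.
by move: IH h0 h1 h2 h3; set u := majorant n; set v := majorant n.+1; nra.
Qed.

Lemma majorant_cauchy (e : R) : 0 < e -> exists N : nat, forall m n : nat,
  (N <= m)%N -> (m <= n)%N -> majorant n - majorant m < e.
Proof.
move=> e0.
have nd : nondecreasing_seq majorant.
  by apply/nondecreasing_seqP; exact: majorant_incr.
have : cvgn majorant.
  apply: nondecreasing_is_cvgn => //; exists 1 => _ [n _ <-].
  by have /andP[] := majorant01 n.
move=> /cvg_ex[l ml].
have lel n : majorant n <= l.
  rewrite -(cvg_lim _ ml)//; apply: nondecreasing_cvgn_le => //.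
  exact: cvgP ml.
have /cvgrPdist_lt/(_ e e0)[N _ hN] := ml.
exists N => m n Nm mn; have := hN m Nm; rewrite /= => /ltr_normlW.
by have := lel n; lra.
Qed.

(** If [y = (b + y ^ 2) / 2] then [(1 - y) ^ 2 = 1 - b]; the iterates of this
    equation are polynomials in [b] with nonnegative coefficients. *)
Fixpoint sqrt_iter b (n : nat) : A :=
  if n is m.+1 then (2^-1)%:C *: (b + sqrt_iter b m * sqrt_iter b m) else 0.

Lemma sqrt_iter_norm b n : cnorm b <= 1 -> cnorm (sqrt_iter b n) <= majorant n.
Proof.
move=> b1; elim: n => [|n IH] /=; first by rewrite cnorm0.
rewrite cnorm_half ler_pM2r ?invr_gt0// (le_trans (cnormD _ _))// lerD//.
by rewrite (le_trans (cnormM _ _))// expr2 ler_pM// cnorm_ge0.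
Qed.

(** Factoring [y * y - x * x] as [y * (y - x) + (y - x) * x] turns each
    increment into the previous one, at most multiplied by the factor that
    occurs for the scalar majorant. *)
Lemma sqrt_iter_step b n : cnorm b <= 1 ->
  cnorm (sqrt_iter b n.+1 - sqrt_iter b n) <= majorant n.+1 - majorant n.
Proof.
move=> b1; elim: n => [|n IH].
  rewrite /= mulr0 addr0 !subr0 expr0n /= addr0 cnorm_half.
  by rewrite ler_pM2r ?invr_gt0.
set y := sqrt_iter b n.+1; set x := sqrt_iter b n.
have -> : sqrt_iter b n.+2 - y = (2^-1)%:C *: (y * (y - x) + (y - x) * x).
  have -> : sqrt_iter b n.+2 = (2^-1)%:C *: (b + y * y) by [].
  have yE : y = (2^-1)%:C *: (b + x * x) by [].
  rewrite -sub_sqr [X in _ *: _ - X]yE -scalerBr opprD.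
  by rewrite addrACA subrr add0r.
rewrite cnorm_half.
have hy : cnorm y <= majorant n.+1 by exact: sqrt_iter_norm.
have hx : cnorm x <= majorant n by exact: sqrt_iter_norm.
have h1 := cnormD (y * (y - x)) ((y - x) * x).
have h2 := cnormM y (y - x); have h3 := cnormM (y - x) x.
rewrite [majorant n.+2]/= -/(majorant n.+1) -/y -/x in IH *.
set d := cnorm (y - x) in h2 h3 IH.
have d0 : 0 <= d := cnorm_ge0 _.
have mE : majorant n.+1 = (1 + majorant n ^+ 2) / 2 by [].
have /andP[u0 _] := majorant01 n; have /andP[v0 _] := majorant01 n.+1.
have : cnorm y * d <= majorant n.+1 * (majorant n.+1 - majorant n).
  by rewrite ler_pM// cnorm_ge0.
have : d * cnorm x <= (majorant n.+1 - majorant n) * majorant n.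
  by rewrite ler_pM// cnorm_ge0.
move: mE h1 h2 h3; set P := cnorm _; set Q := cnorm (y * _); set S := cnorm (_ * x).
move: (cnorm y * d) (d * cnorm x) (majorant n.+1) (majorant n) => s t v u *; lra.
Qed.

Lemma sqrt_iter_dist b m n : cnorm b <= 1 -> (m <= n)%N ->
  cnorm (sqrt_iter b n - sqrt_iter b m) <= majorant n - majorant m.
Proof.
move=> b1 /subnK <-; elim: (n - m)%N => [|k IH].
  by rewrite add0n !subrr cnorm0.
rewrite addSn -(subrK (sqrt_iter b (k + m)) (sqrt_iter b (k + m).+1)) -addrA.
apply: le_trans (cnormD _ _) _.
have := sqrt_iter_step (k + m) b1; lra.
Qed.

Lemma sqrt_iter_commute b z n : b * z = z * b ->
  sqrt_iter b n * z = z * sqrt_iter b n.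
Proof.
move=> bz; elim: n => [|n IH] /=; first by rewrite mul0r mulr0.
rewrite -scalerAl -scalerAr mulrDl mulrDr bz; congr (_ *: (_ + _)).
by rewrite -mulrA IH mulrA IH mulrA.
Qed.

Lemma sqrt_iter_sa b n : star b = b -> star (sqrt_iter b n) = sqrt_iter b n.
Proof.
by move=> bs; elim: n => [|n IH] /=; rewrite ?star0// starZr starD starM IH bs.
Qed.

(** The case [cnorm b = 1], in which the iteration is not a contraction, is the
    one used for absolute values: summability then comes from the bounded
    increasing majorant.  Together with [star y = y], the bound on [y] makes
    [1 - y] itself of the form treated here, hence positive. *)
Lemma sqrt_one_minus b : star b = b -> cnorm b <= 1 ->
  exists y, [/\ star y = y, cnorm y <= 1,
    forall z, b * z = z * b -> y * z = z * y &
    (1 - y) * (1 - y) = 1 - b].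
Proof.
move=> bs b1.
have [y cy] : exists y, (fun n => cnorm (sqrt_iter b n - y)) @ \oo --> (0 : R).
  apply: cnorm_complete => e e0; have [N hN] := majorant_cauchy e0.
  exists N => m n Nm Nn; have [mn|/ltnW nm] := leqP m n.
    by rewrite cnorm_distC (le_lt_trans (sqrt_iter_dist b1 mn))// hN.
  by rewrite (le_lt_trans (sqrt_iter_dist b1 nm))// hN.
have s1 n : cnorm (sqrt_iter b n) <= 1.
  by rewrite (le_trans (sqrt_iter_norm n b1))//; have /andP[] := majorant01 n.
have y1 : cnorm y <= 1.
  have cy1 : (fun n => 1 + cnorm (sqrt_iter b n - y)) @ \oo --> (1 : R).
    by rewrite -[X in _ --> X]addr0; apply: cvgD (cy); exact: cvg_cst.
  rewrite -(cvg_lim _ cy1)//; apply: limr_ge; first exact: cvgP cy1.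
  near=> n; rewrite -[in leLHS](subrKC (sqrt_iter b n) y).
  by rewrite (le_trans (cnormD _ _))// cnorm_distC lerD.
have ysa : star y = y.
  apply/eqP; rewrite -subr_eq0; apply/eqP.
  apply: (cnorm_small_eq0 (K := 2) cy) => n.
  rewrite -(subrKA (sqrt_iter b n)) -{1}(sqrt_iter_sa n bs) -starB.
  rewrite (le_trans (cnormD _ _))// cnorm_star (cnorm_distC y).
  by rewrite mulr2n mulrDl mul1r.
exists y; split => //.
- move=> z bz; apply/eqP; rewrite -subr_eq0; apply/eqP.
  apply: (cnorm_small_eq0 (K := 2 * cnorm z) cy) => n.
  have -> : y * z - z * y
      = z * (sqrt_iter b n - y) - (sqrt_iter b n - y) * z.
    by rewrite mulrBr mulrBl (sqrt_iter_commute n bz) opprB [RHS]addrC subrKA.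
  rewrite (le_trans (cnormB _ _))//.
  have := cnormM z (sqrt_iter b n - y); have := cnormM (sqrt_iter b n - y) z.
  by set p := cnorm (_ * _); set q := cnorm (_ * _); lra.
- suff h : y + y = b + y * y.
    rewrite mulrBr mulr1 mulrBl mul1r opprB addrA.
    by rewrite addrAC -(addrA 1) -opprD h opprD addrA subrK.
  apply/eqP; rewrite -subr_eq0; apply/eqP.
  have cyS : (fun n => cnorm (sqrt_iter b n.+1 - y) + cnorm (sqrt_iter b n - y))
      @ \oo --> (0 : R).
    rewrite -[X in _ --> X]addr0; apply: cvgD (cy).
    by rewrite (cvg_shiftS (fun n => cnorm (sqrt_iter b n - y))).
  apply: (cnorm_small_eq0 (K := 2) cyS) => n.
  set s := sqrt_iter b n.
  have sE : sqrt_iter b n.+1 + sqrt_iter b n.+1 = b + s * s.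
    by rewrite /= -/s -scalerDl half_add_half scale1r.
  have -> : y + y - (b + y * y) =
     (s * (s - y) + (s - y) * y) - (sqrt_iter b n.+1 - y)
      - (sqrt_iter b n.+1 - y).
    rewrite -sub_sqr; move: (s * s) (y * y) sE => p q.
    move: (sqrt_iter b n.+1) => t ttE.
    rewrite -(addrA (p - q)) -opprD addrACA ttE -opprD opprB addrCA.
    congr (_ + _).
    by rewrite (addrC b p) [in RHS]opprD addrACA subrr add0r opprD addrC.
  have h1 := cnormB (s * (s - y) + (s - y) * y - (sqrt_iter b n.+1 - y))
    (sqrt_iter b n.+1 - y).
  have h2 := cnormB (s * (s - y) + (s - y) * y) (sqrt_iter b n.+1 - y).
  have h3 := cnormD (s * (s - y)) ((s - y) * y).
  have h4 := cnormM s (s - y); have h5 := cnormM (s - y) y.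
  have s1n : cnorm s <= 1 := s1 n.
  have d0 := cnorm_ge0 (s - y).
  have : cnorm s * cnorm (s - y) <= cnorm (s - y) by rewrite ler_piMl.
  have : cnorm (s - y) * cnorm y <= cnorm (s - y) by rewrite ler_piMr.
  by lra.
Unshelve. all: by end_near. Qed.


End CStarNorm.

(** * Absolute values and positive functionals *)

Section Positivity.
Variables (R : realType) (A : cstarAlgType R).
Implicit Types (a b x y z : A).

Lemma conj_i : (('i%C : R[i])^*)%R = - 'i.
Proof. by rewrite conjc_def; apply/eqP; rewrite eq_complex /= oppr0 !eqxx. Qed.

Lemma cnormNi a : cnorm (- 'i *: a) = cnorm a.
Proof.
apply: complexI; rewrite cnormZ normrN normc_def /= expr0n expr1n add0r.
by rewrite sqrtr1 mul1r.
Qed.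

Lemma cpositive_sa a : cpositive a -> star a = a.
Proof. by move=> [b ->]; rewrite starM starK. Qed.

Lemma cpositive_one_minus b : star b = b -> cnorm b <= 1 -> cpositive (1 - b).
Proof.
move=> bs b1; have [y [ys _ _ <-]] := sqrt_one_minus bs b1.
by exists (1 - y); rewrite starB star1 ys.
Qed.

Lemma cpositiveZ (r : R) a : 0 <= r -> cpositive a -> cpositive (r%:C *: a : A).
Proof.
move=> r0 [b ->]; exists ((Num.sqrt r)%:C *: b).
by rewrite starZr -scalerAl -scalerAr scalerA -rmorphM -expr2 sqr_sqrtr.
Qed.

Lemma cpositive_norm_sub h : star h = h -> cpositive ((cnorm h)%:C *: 1 - h : A).
Proof.
move=> hs; have [/cnorm_eq0 ->|h0] := eqVneq (cnorm h) 0.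
  by exists 0; rewrite mulr0 cnorm0 scale0r subr0.
have hp : 0 < cnorm h by rewrite lt_def h0 cnorm_ge0.
have -> : (cnorm h)%:C *: 1 - h
    = (cnorm h)%:C *: (1 - (cnorm h)^-1%:C *: h).
  by rewrite scalerBr scalerA -rmorphM /= divff// scale1r.
apply/cpositiveZ/cpositive_one_minus; first exact: cnorm_ge0.
  by rewrite starZr hs.
by rewrite cnormZr ger0_norm ?invr_ge0 ?cnorm_ge0// mulVf.
Qed.

(** The square root of [b * b = 1 - (1 - b * b)] requires
    [cnorm (1 - b * b) <= 1].  With [c] the square root of [1 - b * b], the
    element [u = b + i c] is unitary, so [cnorm u <= 1]; as [c] is the
    imaginary part of [u], [cnorm c <= 1] as well. *)
Lemma absolute_value b : star b = b -> cnorm b <= 1 ->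
  exists d, [/\ cpositive d, d * d = b * b & b * d = d * b].
Proof.
move=> bs b1.
have bb1 : cnorm (b * b) <= 1.
  by rewrite cnorm_sqr_sa// expr_le1// cnorm_ge0.
have bbs : star (b * b) = b * b by rewrite starM bs.
have [y [ys _ yC yE]] := sqrt_one_minus bbs bb1.
set c := 1 - y in yE.
have cs : star c = c by rewrite starB star1 ys.
have bc : b * c = c * b.
  by rewrite mulrBr mulrBl mulr1 mul1r yC// mulrA.
have c1 : cnorm c <= 1.
  pose u := b + 'i *: c.
  have us : star u = b - 'i *: c.
    by rewrite starD starZ bs cs conj_i scaleNr.
  have uu : star u * u = 1.
    rewrite us mulrBl !mulrDr -!scalerAl -!scalerAr bc scalerA -(expr2 'i) sqr_i yE.
    by rewrite scaleN1r opprB addrACA subrr addr0 addrC subrK.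
  have u1 : cnorm u <= 1.
    have := cnorm_starM u; rewrite uu => e.
    by rewrite -(@expr_le1 _ 2)// ?cnorm_ge0// -e cnorm1_le1.
  have cE : c = (2^-1)%:C *: (- 'i *: (u - star u)).
    rewrite us /u opprB [X in - 'i *: X]addrC addrA subrK (scalerDr (- 'i)) scalerA.
    by rewrite mulNr -(expr2 'i) sqr_i opprK scale1r scalerDr -scalerDl half_add_half scale1r.
  rewrite {}cE cnorm_half ler_pdivrMr// mul1r.
  rewrite cnormNi.
  by have := cnormB u (star u); rewrite cnorm_star; lra.
have cc1 : cnorm (c * c) <= 1 by rewrite cnorm_sqr_sa// expr_le1// cnorm_ge0.
have ccs : star (c * c) = c * c by rewrite starM cs.
have [v [vs v1 vC vE]] := sqrt_one_minus ccs cc1.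
exists (1 - v); split; first exact: cpositive_one_minus.
  by rewrite vE yE opprB addrC subrK.
rewrite mulrBr mulrBl mulr1 mul1r; congr (_ - _); apply/esym/vC.
by rewrite -mulrA -bc mulrA -bc mulrA.
Qed.

Lemma cartesian_decomposition a : exists h k : A,
  [/\ star h = h, star k = k, cnorm h <= cnorm a, cnorm k <= cnorm a &
      a = h + 'i *: k /\ star a = h - 'i *: k].
Proof.
exists ((2^-1)%:C *: (a + star a)), ((2^-1)%:C *: (- 'i *: (a - star a))); split.
- by rewrite starZr starD starK addrC.
- by rewrite starZr starZ rmorphN /= conj_i opprK starB starK -opprB scalerN scaleNr.
- rewrite cnorm_half ler_pdivrMr//.
  by have := cnormD a (star a); rewrite cnorm_star; lra.
- rewrite cnorm_half ler_pdivrMr// cnormNi.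
  by have := cnormB a (star a); rewrite cnorm_star; lra.
- have -> : 'i *: ((2^-1)%:C *: (- 'i *: (a - star a)))
      = (2^-1)%:C *: (a - star a).
    by rewrite !scalerA mulrAC mulrN -(expr2 'i) sqr_i opprK mul1r.
  rewrite -scalerDr -scalerBr; split.
    by rewrite addrACA subrr addr0 scalerDr -scalerDl half_add_half scale1r.
  rewrite opprB addrC addrA subrK.
  by rewrite scalerDr -scalerDl half_add_half scale1r.
Qed.

Definition positive_functional (f : A -> R[i]) : Prop :=
  (forall (c : R[i]) a b, f (c *: a + b) = c * f a + f b) /\
  (forall a, cpositive a -> 0 <= f a).

Section PositiveFunctional.
Variable f : A -> R[i].
Hypothesis fP : positive_functional f.

Lemma pf_add a b : f (a + b) = f a + f b.
Proof. by rewrite -[a]scale1r fP.1 mul1r scale1r. Qed.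

Lemma pf0 : f 0 = 0.
Proof. by apply: (addrI (f 0)); rewrite -pf_add !addr0. Qed.

Lemma pf_scale c a : f (c *: a) = c * f a.
Proof. by rewrite -[c *: a]addr0 fP.1 pf0 addr0. Qed.

Lemma pf_sub a b : f (a - b) = f a - f b.
Proof. by rewrite -scaleN1r pf_add pf_scale mulN1r. Qed.

Lemma pf1_real : f 1 = (complex.Re (f 1))%:C.
Proof.
have : 0 <= f 1 by apply: fP.2; exists 1; rewrite star1 mulr1.
by rewrite lecE => /andP[/eqP i0 _]; rewrite [LHS]complexE i0 mulr0 addr0.
Qed.

(** Both [cnorm h - h] and [cnorm h + h] are positive. *)
Lemma pf_sa_bound h : star h = h ->
  complex.Im (f h) = 0 /\ `|complex.Re (f h)| <= cnorm h * complex.Re (f 1).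
Proof.
move=> hs.
have nhs : star (- h) = - h by rewrite starN hs.
have := fP.2 _ (cpositive_norm_sub hs); have := fP.2 _ (cpositive_norm_sub nhs).
rewrite cnormN opprK !(pf_sub, pf_add) !pf_scale pf1_real.
case: (f h) => u v; move: (complex.Re (f 1)) => t; rewrite !lecE /=.
rewrite !mul0r !mulr0 !subr0 !addr0 !add0r.
move=> /andP[_ h1] /andP[/eqP h2 h3]; split; first by lra.
by rewrite ler_norml; apply/andP; split; lra.
Qed.

(** The factor 2 comes from bounding the two self-adjoint parts separately;
    any constant would do for continuity in norm. *)
Lemma pf_sa_functional :
  (forall a, f (star a) = ((f a)^*)%R) /\
  (forall a, `|f a| <= (2 * complex.Re (f 1) * cnorm a)%:C).
Proof.
split=> a; have [h [k [hs ks ha ka [aE saE]]]] := cartesian_decomposition a;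
  have [h0 hb] := pf_sa_bound hs; have [k0 kb] := pf_sa_bound ks.
  rewrite saE aE pf_sub pf_add pf_scale conjc_def.
  case: (f h) h0 => ? ? /= ->; case: (f k) k0 => ? ? /= ->.
  by apply/eqP; rewrite eq_complex /=; apply/andP; split; apply/eqP; ring.
have f10 : 0 <= complex.Re (f 1).
  have : 0 <= f 1 by apply: fP.2; exists 1; rewrite star1 mulr1.
  by rewrite lecE => /andP[].
rewrite aE pf_add pf_scale (le_trans (ler_normD _ _))//.
rewrite normrM normc_def [`|'i|]normc_def [`|f k|]normc_def /= h0 k0.
rewrite expr0n expr1n /= add0r sqrtr1 mul1r !addr0 !sqrtr_sqr -rmorphD lecR -aE.
have : cnorm h * complex.Re (f 1) <= cnorm a * complex.Re (f 1) by rewrite ler_wpM2r.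
have : cnorm k * complex.Re (f 1) <= cnorm a * complex.Re (f 1) by rewrite ler_wpM2r.
by lra.
Qed.

Lemma pf_sa_dual : sa_functional f.
Proof.
have [h1 h2] := pf_sa_functional; split => //; first exact: fP.1.
by exists (2 * complex.Re (f 1)).
Qed.

End PositiveFunctional.

(** For self-adjoint [h], the inequality at [cnorm h - h] is the reverse of the
    inequality at [h]. *)
Lemma pf_eq (f g : A -> R[i]) : positive_functional f -> positive_functional g ->
  f 1 = g 1 -> (forall a, cpositive a -> f a <= g a) -> forall a, f a = g a.
Proof.
move=> fP gP fg1 fg.
suff sa h : star h = h -> f h = g h.
  move=> a; have [h [k [hs ks _ _ [-> _]]]] := cartesian_decomposition a.
  by rewrite !(pf_add fP, pf_add gP, pf_scale fP, pf_scale gP) !sa.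
suff le h' : star h' = h' -> g h' <= f h'.
  move=> hs; apply/eqP; rewrite eq_le le// andbT -lerN2.
  have := le (- h); rewrite starN hs => /(_ erefl).
  by rewrite -(scaleN1r h) (pf_scale fP) (pf_scale gP) !mulN1r.
move=> hs; have := fg _ (cpositive_norm_sub hs).
by rewrite (pf_sub fP) (pf_sub gP) (pf_scale fP) (pf_scale gP) fg1 lerD2l lerN2.
Qed.

End Positivity.

(** * Positive operators on a Hilbert space *)

Lemma discriminant_le (R : realFieldType) (p s r : R) : 0 <= r ->
  (forall t, 0 <= p - 2 * t * s + t ^+ 2 * r) -> s ^+ 2 <= p * r.
Proof.
move=> r0 h; have [r00|r00] := eqVneq r 0.
  rewrite r00 in h *; rewrite mulr0.
  have [->|s0] := eqVneq s 0; first by rewrite expr0n.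
  have := h ((p + 1) / (2 * s)).
  have -> : p - 2 * ((p + 1) / (2 * s)) * s + ((p + 1) / (2 * s)) ^+ 2 * 0 = -1.
    by field.
  by lra.
have rp : 0 < r by rewrite lt_def r00.
have := h (s / r).
have -> : p - 2 * (s / r) * s + (s / r) ^+ 2 * r = (p * r - s ^+ 2) / r by field.
by rewrite pmulr_lge0 ?invr_gt0// subr_ge0.
Qed.

Section InnerProduct.
Variables (R : realType) (H : hilbertType R).
Implicit Types (x y z : H) (S T : H -> H).

(** The square of the norm as an element of [R]; the norm of [H] takes its
    values in [R[i]]. *)
Definition nsq x : R := complex.Re (inner x x).

Lemma innerDl x y z : inner (x + y) z = inner x z + inner y z.
Proof. by rewrite -[x]scale1r innerPl mul1r scale1r. Qed.

Lemma inner0l z : inner (0 : H) z = 0.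
Proof. by apply: (addrI (inner 0 z)); rewrite -innerDl !addr0. Qed.

Lemma innerZl c x z : inner (c *: x) z = c * inner x z.
Proof. by rewrite -[c *: x]addr0 innerPl inner0l addr0. Qed.

Lemma innerBl x y z : inner (x - y) z = inner x z - inner y z.
Proof. by rewrite -scaleN1r innerDl innerZl mulN1r. Qed.

Lemma innerZr c x z : inner x (c *: z) = (c^*)%R * inner x z.
Proof. by rewrite innerC innerZl rmorphM /= -innerC. Qed.

Lemma innerBr x y z : inner z (x - y) = inner z x - inner z y.
Proof. by rewrite innerC innerBl rmorphB /= -!innerC. Qed.

Lemma Re_innerC x y : complex.Re (inner x y) = complex.Re (inner y x).
Proof. by rewrite innerC conjc_def. Qed.

Lemma hnormE x : `|x| = (complex.Re `|x|)%:C.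
Proof.
have : 0 <= `|x| by [].
by rewrite lecE => /andP[/eqP i0 _]; rewrite [LHS]complexE i0 mulr0 addr0.
Qed.

Lemma nsqE x : nsq x = complex.Re `|x| ^+ 2.
Proof. by rewrite /nsq inner_norm hnormE -rmorphXn. Qed.

Lemma inner_nsq x : inner x x = (nsq x)%:C.
Proof. by rewrite nsqE inner_norm [in LHS]hnormE rmorphXn. Qed.

Lemma Re_hnorm_ge0 x : 0 <= complex.Re `|x|.
Proof. by rewrite -ler0c -hnormE. Qed.

Lemma nsq_ge0 x : 0 <= nsq x.
Proof. by rewrite nsqE sqr_ge0. Qed.

Lemma nsq_eq0 x : nsq x = 0 -> x = 0.
Proof.
rewrite nsqE => /eqP; rewrite sqrf_eq0 => /eqP h.
by apply/normr0_eq0; rewrite hnormE h.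
Qed.

Lemma nsqZ (r : R) x : nsq (r%:C *: x) = r ^+ 2 * nsq x.
Proof.
rewrite /nsq innerZl innerZr conj_real_complex inner_nsq -!rmorphM /=.
by rewrite mulrA.
Qed.

Lemma Re_realM (r : R) (z : R[i]) : complex.Re (r%:C * z) = r * complex.Re z.
Proof. by case: z => u v /=; rewrite mul0r subr0. Qed.

Lemma Re_sub (z w : R[i]) : complex.Re (z - w) = complex.Re z - complex.Re w.
Proof. by case: z; case: w. Qed.

Lemma positive_cauchy_schwarz S x y : linear S ->
  (forall u v, inner (S u) v = inner u (S v)) ->
  (forall u, 0 <= complex.Re (inner (S u) u)) ->
  complex.Re (inner (S x) y) ^+ 2
    <= complex.Re (inner (S x) x) * complex.Re (inner (S y) y).
Proof.
move=> Sl Ss S0; apply: discriminant_le => // t.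
suff -> : complex.Re (inner (S x) x) - 2 * t * complex.Re (inner (S x) y)
    + t ^+ 2 * complex.Re (inner (S y) y)
  = complex.Re (inner (S (x - t%:C *: y)) (x - t%:C *: y)) by [].
have -> : S (x - t%:C *: y) = S x - t%:C *: S y.
  by rewrite addrC -scaleNr Sl scaleNr addrC.
rewrite !(innerBl, innerBr, innerZl, innerZr) conj_real_complex.
rewrite (Ss y x) !(Re_sub, Re_realM) (Re_innerC y (S x)).
by ring.
Qed.

Lemma cauchy_schwarz x y : complex.Re (inner x y) ^+ 2 <= nsq x * nsq y.
Proof.
by apply: (@positive_cauchy_schwarz id) => // u; exact: nsq_ge0.
Qed.

(** Bounds on the quadratic form of a positive operator pass to its norm through
    this instance [y = S x] of Cauchy-Schwarz. *)
Lemma positive_image_le S x : linear S ->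
  (forall u v, inner (S u) v = inner u (S v)) ->
  (forall u, 0 <= complex.Re (inner (S u) u)) ->
  nsq (S x) ^+ 2
    <= complex.Re (inner (S x) x) * complex.Re (inner (S (S x)) (S x)).
Proof. by move=> *; exact: positive_cauchy_schwarz. Qed.

Lemma inner_eq0 x : (forall y, inner x y = 0) -> x = 0.
Proof. by move=> h; apply: nsq_eq0; rewrite /nsq h. Qed.

Lemma normalize x : x != 0 -> exists r : R, 0 < r /\ nsq (r%:C *: x) = 1.
Proof.
move=> x0; have nx : nsq x != 0 by apply: contra x0 => /eqP/nsq_eq0 ->.
have np : 0 < nsq x by rewrite lt_def nx nsq_ge0.
exists (Num.sqrt (nsq x))^-1; rewrite invr_gt0 sqrtr_gt0 nsqZ; split=> //.
by rewrite exprVn sqr_sqrtr ?nsq_ge0// mulVf.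
Qed.

Lemma linear_op0 T : linear T -> T 0 = 0.
Proof. by move=> Tl; have := Tl (-1) 0 0; rewrite scaler0 addr0 scaleN1r addNr. Qed.

Lemma linear_opZ T c x : linear T -> T (c *: x) = c *: T x.
Proof. by move=> Tl; rewrite -[c *: x]addr0 Tl linear_op0 ?addr0. Qed.

Lemma opnorm_le T (c : R) : 0 <= c ->
  (forall x, nsq (T x) <= c ^+ 2 * nsq x) -> opnorm T <= c.
Proof.
move=> c0 h; rewrite /opnorm; apply: ge_sup.
  by exists (complex.Re `|T 0|); exists 0; rewrite ?normr0 ?ler01 -?hnormE.
move=> r [x]; rewrite hnormE -[1]/(1%:C) lecR => x1.
rewrite hnormE => /complexI ->.
rewrite -(@ler_pXn2r _ 2) ?nnegrE ?Re_hnorm_ge0// -nsqE.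
apply: le_trans (h x) _; rewrite ler_piMr ?sqr_ge0// nsqE expr_le1 ?Re_hnorm_ge0//.
Qed.

Lemma nsq_opnorm T (K : R) x : linear T -> 0 <= K ->
  (forall x, nsq (T x) <= K ^+ 2 * nsq x) ->
  0 <= opnorm T /\ nsq (T x) <= opnorm T ^+ 2 * nsq x.
Proof.
move=> Tl K0 h.
have T0 := linear_op0 Tl.
set E := [set r : R | exists2 x : H, `|x| <= 1 & r%:C = `|T x|].
have E0 : E 0 by exists 0; rewrite ?normr0 ?ler01 ?T0 ?normr0.
have supE : has_sup E.
  split; first by exists 0.
  exists K => r [u]; rewrite hnormE -[1]/(1%:C) lecR => u1.
  rewrite hnormE => /complexI ->.
  rewrite -(@ler_pXn2r _ 2) ?nnegrE ?Re_hnorm_ge0// -nsqE.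
  apply: le_trans (h u) _.
  by rewrite ler_piMr ?sqr_ge0// nsqE expr_le1 ?Re_hnorm_ge0.
have op0 : 0 <= opnorm T by apply: (sup_upper_bound supE).
split=> //; have [->|x0] := eqVneq x 0.
  by rewrite T0 /nsq inner0l mulr0.
have [r [r0 nr]] := normalize x0.
have : complex.Re `|T (r%:C *: x)| <= opnorm T.
  apply: (sup_upper_bound supE); exists (r%:C *: x); last by rewrite -hnormE.
  rewrite hnormE -[1]/(1%:C) lecR -(@expr_le1 _ 2) ?Re_hnorm_ge0//.
  by rewrite -nsqE nr.
rewrite -(@ler_pXn2r _ 2) ?nnegrE ?Re_hnorm_ge0// -nsqE linear_opZ// nsqZ => hh.
have r2 : 0 < r ^+ 2 by rewrite exprn_gt0.
by rewrite -(ler_pM2l r2) mulrCA -(nsqZ r x) nr mulr1.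
Qed.

End InnerProduct.

(** * Representations: positivity and operator norms *)

Section Representation.
Variables (R : realType) (H : hilbertType R) (A : cstarAlgType R).
Variable iota : A -> H -> H.
Hypothesis iota_linear : linear iota.
Hypothesis iota_mul : forall a b, iota (a * b) = iota a \o iota b.
Hypothesis iota_star : forall a, is_adjoint (iota a) (iota (star a)).
Hypothesis iota1 : iota 1 = id.
Implicit Types (a b h : A) (x y z : H).

Lemma repP c a b x : iota (c *: a + b) x = c *: iota a x + iota b x.
Proof. by rewrite iota_linear. Qed.

Lemma repD a b x : iota (a + b) x = iota a x + iota b x.
Proof. by rewrite -[a]scale1r repP !scale1r. Qed.

Lemma rep0 x : iota 0 x = 0.
Proof. by apply: (addrI (iota 0 x)); rewrite -repD !addr0. Qed.

Lemma repZ c a x : iota (c *: a) x = c *: iota a x.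
Proof. by rewrite -[c *: a]addr0 repP rep0 addr0. Qed.

Lemma repB a b x : iota (a - b) x = iota a x - iota b x.
Proof. by rewrite -scaleN1r repD repZ scaleN1r. Qed.

Lemma repM a b x : iota (a * b) x = iota a (iota b x).
Proof. by rewrite iota_mul. Qed.

(** An operator that has an adjoint is linear. *)
Lemma iota_op_linear a : linear (iota a).
Proof.
move=> c x y; apply/eqP; rewrite -subr_eq0; apply/eqP.
apply: inner_eq0 => z; rewrite innerBl innerPl !iota_star innerPl.
by rewrite subrr.
Qed.

Lemma inner_iota_sqr b x y : inner (iota (star b * b) x) y = inner (iota b x) (iota b y).
Proof. by rewrite repM iota_star starK. Qed.

Definition vector_functional x a : R[i] := inner (iota a x) x.

Lemma vector_functional_positive x : positive_functional (vector_functional x).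
Proof.
split=> [c a b|a [b ->]]; rewrite /vector_functional; first by rewrite repP innerPl.
by rewrite inner_iota_sqr inner_nsq ler0c nsq_ge0.
Qed.

Lemma quad_ge0 a x : cpositive a -> 0 <= complex.Re (inner (iota a x) x).
Proof.
by move=> /((vector_functional_positive x).2); rewrite lecE => /andP[].
Qed.

Lemma iota_sym h x y : star h = h -> inner (iota h x) y = inner x (iota h y).
Proof. by move=> hs; rewrite iota_star hs. Qed.

Lemma vector_functional1 x : vector_functional x 1 = (nsq x)%:C.
Proof. by rewrite /vector_functional iota1 inner_nsq. Qed.

(** Continuity of a representation is automatic: vector functionals are positive,
    hence bounded. *)
Lemma iota_contraction a x : nsq (iota a x) <= cnorm a ^+ 2 * nsq x.
Proof.
have sa : star (star a * a) = star a * a by rewrite starM starK.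
have [_] := pf_sa_bound (vector_functional_positive x) sa.
rewrite vector_functional1 /vector_functional inner_iota_sqr cnorm_starM.
by rewrite /= -/(nsq _); apply: le_trans; rewrite ler_norm.
Qed.

Section Injective.
Hypothesis iota_inj : injective iota.

Lemma kernel_trivial a : (forall x, iota a x = 0) -> a = 0.
Proof. by move=> h; apply/iota_inj/funext => x; rewrite h rep0. Qed.

(** With [d] the absolute value of [b] and [w = b - d], one has
    [w * (b + d) * w = 0], because [b] and [d] commute and have equal squares.
    In the representation this is a sum of two positive forms, so [iota b] and
    [iota d] vanish on the range of [iota w], and so does [iota w]. *)
Lemma positive_reflect_contraction b : star b = b -> cnorm b <= 1 ->
  (forall x, 0 <= complex.Re (inner (iota b x) x)) -> cpositive b.
Proof.
move=> bs b1 bpos; have [d [dpos dd bd]] := absolute_value bs b1.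
have ds := cpositive_sa dpos.
suff w0 : b - d = 0 by rewrite (subr0_eq w0).
set w := b - d; have ws : star w = w by rewrite starB bs ds.
have wbw : w * b * w + w * d * w = 0.
  rewrite -mulrDl -mulrDr [w * (b + d)](_ : _ = 0) ?mul0r//.
  by rewrite mulrDr !mulrBl dd bd subrKA subrr.
suff ww : w * w = 0.
  by apply: cnorm_eq0; apply/eqP; rewrite -sqrf_eq0 -cnorm_sqr_sa// ww cnorm0.
apply: kernel_trivial => x; rewrite repM; set z := iota w x.
have dpos' u := quad_ge0 u dpos.
have sum0 : complex.Re (inner (iota b z) z) + complex.Re (inner (iota d z) z) = 0.
  have : inner (iota (w * b * w + w * d * w) x) x = 0 by rewrite wbw rep0 inner0l.
  rewrite repD innerDl !repM !(iota_sym _ _ ws) -/z.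
  by case: (inner _ _) => ? ?; case: (inner _ _) => ? ? /= -[].
have vanish c : star c = c -> (forall u, 0 <= complex.Re (inner (iota c u) u)) ->
    complex.Re (inner (iota c z) z) = 0 -> iota c z = 0.
  move=> cs cpos cz; apply: nsq_eq0; apply/eqP.
  have := positive_image_le z (iota_op_linear c) (fun u v => iota_sym u v cs) cpos.
  by rewrite cz mul0r => h; rewrite -sqrf_eq0 eq_le h sqr_ge0.
have hb := bpos z; have hd := dpos' z.
have bz : iota b z = 0 by apply: vanish => //; lra.
have dz : iota d z = 0 by apply: vanish => //; lra.
by rewrite repB bz dz subrr.
Qed.

Lemma positive_reflect b : star b = b ->
  (forall x, 0 <= complex.Re (inner (iota b x) x)) -> cpositive b.
Proof.
move=> bs bpos; set r := cnorm b + 1.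
have r0 : 0 < r by rewrite ltr_wpDl// cnorm_ge0.
have -> : b = r%:C *: (r^-1%:C *: b).
  by rewrite scalerA -rmorphM /= divff ?scale1r// gt_eqF.
apply: cpositiveZ; first exact: ltW.
apply: positive_reflect_contraction; first by rewrite starZr bs.
  rewrite cnormZr ger0_norm ?invr_ge0; last exact: ltW.
  by rewrite mulrC ler_pdivrMr// mul1r lerDl.
by move=> x; rewrite repZ innerZl Re_realM mulr_ge0// invr_ge0 ltW.
Qed.

Lemma nsq_iota_opnorm a x : 0 <= opnorm (iota a) /\
  nsq (iota a x) <= opnorm (iota a) ^+ 2 * nsq x.
Proof.
exact: nsq_opnorm (iota_op_linear a) (cnorm_ge0 a) (iota_contraction a).
Qed.

Lemma quad_le_opnorm a x :
  complex.Re (inner (iota a x) x) <= opnorm (iota a) * nsq x.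
Proof.
have [c0 h] := nsq_iota_opnorm a x.
have [q0|/ltW q0] := leP 0 (complex.Re (inner (iota a x) x)); last first.
  by rewrite (le_trans q0)// mulr_ge0// nsq_ge0.
rewrite -(@ler_pXn2r _ 2) ?nnegrE ?mulr_ge0 ?nsq_ge0//.
apply: le_trans (cauchy_schwarz _ _) _.
by rewrite exprMn [nsq x ^+ 2]expr2 mulrA ler_wpM2r// nsq_ge0.
Qed.

(** An order bound in the algebra [A], valid for all its states, obtained from
    the norm of an operator on [H]. *)
Lemma opnorm_sub_positive a : cpositive a ->
  cpositive ((opnorm (iota a))%:C *: 1 - a : A).
Proof.
move=> ap; apply: positive_reflect.
  by rewrite starB starZr star1 cpositive_sa.
move=> x; rewrite repB repZ iota1 innerBl innerZl Re_sub Re_realM subr_ge0.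
exact: quad_le_opnorm.
Qed.

End Injective.

(** The norm of a positive operator is the supremum of its quadratic form on the
    unit sphere. *)
Lemma opnorm_approx a (e : R) : cpositive a -> 0 < e -> (exists x : H, x != 0) ->
  exists x, nsq x = 1 /\ opnorm (iota a) - e < complex.Re (inner (iota a x) x).
Proof.
move=> ap e0 [x0 x00]; apply: contrapT => no.
set c := opnorm (iota a) - e.
have quad_le x : nsq x = 1 -> complex.Re (inner (iota a x) x) <= c.
  by move=> nx; rewrite leNgt; apply/negP => lt; apply: no; exists x.
have c0 : 0 <= c.
  have [r [_ nr]] := normalize x00.
  by apply: le_trans (quad_le _ nr); exact: quad_ge0.
have quad_leM x : complex.Re (inner (iota a x) x) <= c * nsq x.
  have [->|xn0] := eqVneq x 0.
    by rewrite linear_op0 ?/nsq ?inner0l ?mulr0//; exact: iota_op_linear.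
  have [r [r0 nr]] := normalize xn0.
  have r2 : 0 < r ^+ 2 by rewrite exprn_gt0.
  rewrite -(ler_pM2l r2) mulrCA -(nsqZ r x) nr mulr1.
  have aZ : iota a (r%:C *: x) = r%:C *: iota a x.
    by rewrite linear_opZ//; exact: iota_op_linear.
  have := quad_le _ nr; rewrite aZ innerZl innerZr conj_real_complex.
  by rewrite !Re_realM mulrA.
suff : opnorm (iota a) <= c by rewrite /c; lra.
apply: opnorm_le => // x.
have sa := cpositive_sa ap.
have := positive_image_le x (iota_op_linear a) (fun u v => iota_sym u v sa)
  (fun u => quad_ge0 u ap).
have q1 := quad_leM x; have q2 := quad_leM (iota a x).
have p1 := quad_ge0 x ap; have p2 := quad_ge0 (iota a x) ap.
have n1 := nsq_ge0 x; have n2 := nsq_ge0 (iota a x).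
move=> le; have [->|n0] := eqVneq (nsq (iota a x)) 0.
  by rewrite mulr_ge0// sqr_ge0.
have np : 0 < nsq (iota a x) by rewrite lt_def n0.
rewrite -(ler_pM2r np) -expr2; apply: le_trans le _.
apply: le_trans (ler_pM p1 p2 q1 q2) _.
by rewrite mulrACA -expr2 mulrA.
Qed.

End Representation.

(** * Limits along ultrafilters *)

Section UltraLimits.
Variable R : realType.

Lemma fmap_ultra (T T' : Type) (f : T -> T') (U : set_system T) :
  UltraFilter U -> UltraFilter (f @ U).
Proof.
move=> UU; split=> [|G GG sUG]; first exact: fmap_proper_filter.
rewrite predeqE => B; split; last exact: sUG.
move=> GB; have [//|UnB] := in_ultra_setVsetC (f @^-1` B) UU.
have GnB : G (~` B) by apply: sUG.
by have /filter_ex [? []] : G (B `&` ~` B) by exact: filterI.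
Qed.

Lemma ultra_bounded_cvg (U : set_system nat) (u : nat -> R) (K : R) :
  UltraFilter U -> (forall n, `|u n| <= K) -> exists l : R, u @ U --> l.
Proof.
move=> UU uK; have := @segment_compact R (- K) K.
rewrite compact_ultra => /(_ (u @ U) (fmap_ultra u UU)) [].
  apply: (@filterS _ U _ setT); last exact: filterT.
  move=> n _ /=.
  by rewrite in_itv /= -ler_norml.
by move=> l [_ ul]; exists l.
Qed.

(** If [s] stays at distance at least [e] from [l] frequently, some free
    ultrafilter concentrates on the indices where it does. *)
Lemma cvg_of_ultra (s : nat -> R) (l : R) :
  (forall U : set_system nat, UltraFilter U -> U --> \oo -> s @ U --> l) ->
  s @ \oo --> l.
Proof.
move=> h; apply: contrapT => ns.
have [e e0 ne] : exists2 e : R, 0 < e & ~ \forall n \near \oo, `|l - s n| < e.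
  apply: contrapT => no; apply: ns; apply/cvgrPdist_lt => e e0.
  by apply: contrapT => ne; apply: no; exists e.
pose D : set nat := [set n | e <= `|l - s n|].
have WF : ProperFilter (within D \oo).
  split; last exact: within_filter.
  rewrite /within /= => F; apply: ne; near do idtac.
  by apply: filterS F => n Dn; rewrite ltNge; apply/negP.
have [U [UU WU]] := ultraFilterLemma WF.
have Uoo : U --> \oo.
  by move=> B BN; apply: WU; rewrite /within /=; apply: filterS BN.
have UD : U D by apply: WU; rewrite /within /=; apply: filterS filterT.
have /cvgrPdist_lt/(_ e e0) near_l := h U UU Uoo.
have : U set0.
  by apply: filterS2 UD near_l => n; rewrite /D /= leNgt => /negP.
exact: filter_not_empty.
Unshelve. all: by end_near. Qed.

End UltraLimits.

Section StateLimits.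
Variables (R : realType) (A : cstarAlgType R).

Lemma Re_add (z w : R[i]) : complex.Re (z + w) = complex.Re z + complex.Re w.
Proof. by case: z; case: w. Qed.

Lemma Im_add (z w : R[i]) : complex.Im (z + w) = complex.Im z + complex.Im w.
Proof. by case: z; case: w. Qed.

Lemma Re_mul (z w : R[i]) : complex.Re (z * w) =
  complex.Re z * complex.Re w - complex.Im z * complex.Im w.
Proof. by case: z; case: w. Qed.

Lemma Im_mul (z w : R[i]) : complex.Im (z * w) =
  complex.Re z * complex.Im w + complex.Im z * complex.Re w.
Proof. by case: z; case: w. Qed.

Lemma complex_eqP (z w : R[i]) :
  complex.Re z = complex.Re w -> complex.Im z = complex.Im w -> z = w.
Proof. by case: z => ? ?; case: w => ? ? /= -> ->. Qed.

Lemma ge0_complex (z : R[i]) : 0 <= z <-> complex.Im z = 0 /\ 0 <= complex.Re z.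
Proof. by rewrite lecE; split => [/andP[/eqP]|[-> ->]]; rewrite ?eqxx. Qed.

Lemma normc_Re_le (z : R[i]) (K : R) : `|z| <= K%:C -> `|complex.Re z| <= K.
Proof. by move=> h; rewrite -lecR; apply: le_trans h; exact: normc_ge_Re. Qed.

Lemma normc_Im_le (z : R[i]) (K : R) : `|z| <= K%:C -> `|complex.Im z| <= K.
Proof.
move=> h; have -> : complex.Im z = complex.Re (- 'i * z).
  by rewrite Re_mul /=; ring.
by apply: normc_Re_le; rewrite normrM normrN normc_def /= expr0n expr1n add0r sqrtr1 mul1r.
Qed.

(** Weak-star compactness of the set of positive functionals of norm at most 1,
    in the form used below. *)
Lemma ultralimit_functional (U : set_system nat) (f : nat -> A -> R[i]) :
  UltraFilter U -> (forall n, positive_functional (f n)) ->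
  (forall n, complex.Re (f n 1) <= 1) ->
  exists phi : A -> R[i], positive_functional phi /\
    forall a, (fun n => complex.Re (f n a)) @ U --> complex.Re (phi a).
Proof.
move=> UU fP f1.
have bnd n a : `|f n a| <= (2 * cnorm a)%:C.
  apply: le_trans ((pf_sa_functional (fP n)).2 a) _.
  by rewrite lecR ler_wpM2r ?cnorm_ge0//; have := f1 n; lra.
have exlim a : exists z : R[i],
    (fun n => complex.Re (f n a)) @ U --> complex.Re z /\
    (fun n => complex.Im (f n a)) @ U --> complex.Im z.
  have [x hx] := ultra_bounded_cvg UU (fun n => normc_Re_le (bnd n a)).
  have [y hy] := ultra_bounded_cvg UU (fun n => normc_Im_le (bnd n a)).
  by exists (x +i* y).
have [phi hphi] := choice exlim.
exists phi; split; last by move=> a; case: (hphi a).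
have hR : hausdorff_space R by exact: norm_hausdorff.
have PU : ProperFilter U by exact: ultra_proper.
split=> [c a b|a ap].
  have [ra ia] := hphi a; have [rb ib] := hphi b.
  have [rc ic] := hphi (c *: a + b).
  apply: complex_eqP; [apply: (cvg_unique hR rc)|apply: (cvg_unique hR ic)].
    rewrite Re_add Re_mul /=.
    have -> : (fun n => complex.Re (f n (c *: a + b))) = (fun n =>
        complex.Re c * complex.Re (f n a) - complex.Im c * complex.Im (f n a)
        + complex.Re (f n b)) by apply/funext => n; rewrite (fP n).1 Re_add Re_mul.
    by apply: cvgD (rb); apply: cvgB; apply: cvgMr.
  rewrite Im_add Im_mul /=.
  have -> : (fun n => complex.Im (f n (c *: a + b))) = (fun n =>
      complex.Re c * complex.Im (f n a) + complex.Im c * complex.Re (f n a)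
      + complex.Im (f n b)) by apply/funext => n; rewrite (fP n).1 Im_add Im_mul.
  by apply: cvgD (ib); apply: cvgD; apply: cvgMr.
have [ra ia] := hphi a.
have fa n := (ge0_complex _).1 ((fP n).2 a ap).
apply/ge0_complex; split.
  apply: (cvg_unique hR ia).
  rewrite (_ : (fun n => complex.Im (f n a)) = fun=> 0); first exact: cvg_cst.
  by apply/funext => n; have [] := fa n.
rewrite -(cvg_lim _ ra)//; apply: limr_ge; first exact: cvgP ra.
by apply: filterS filterT => n _; have [] := fa n.
Qed.

End StateLimits.

(** * Averages of states over orbits *)

Section ErgodicAverages.
Variables (R : realType) (A : cstarAlgType R) (Theta : int -> A -> A).
Hypothesis HT : cstar_system Theta.
Implicit Types (a b c : A) (g f : A -> R[i]).

Lemma aut1 n : Theta n 1 = 1.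
Proof.
have [[inv _ invK] _ autM _] := HT.2 n.
by rewrite -[RHS]invK -[inv 1]mul1r autM invK mulr1.
Qed.

Lemma aut_positive n a : cpositive a -> cpositive (Theta n a).
Proof.
have [_ _ autM autS] := HT.2 n.
by move=> [b ->]; exists (Theta n b); rewrite autM autS.
Qed.

Lemma autP n (c : R[i]) a b : Theta n (c *: a + b) = c *: Theta n a + Theta n b.
Proof. by have [_ -> _ _] := HT.2 n. Qed.

Lemma autZ n (c : R[i]) a : Theta n (c *: a) = c *: Theta n a.
Proof.
have T0 : Theta n 0 = 0.
  by have := autP n (-1) 0 0; rewrite scaler0 addr0 scaleN1r addNr.
by rewrite -[c *: a]addr0 autP T0 addr0.
Qed.

Lemma positive_functional_aut n f :
  positive_functional f -> positive_functional (f \o Theta n).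
Proof.
move=> fP; split=> [c a b|a ap] /=; first by rewrite autP fP.1.
exact/fP.2/aut_positive.
Qed.

Lemma aut_bound n f a : positive_functional f -> complex.Re (f 1) = 1 ->
  `|f (Theta n a)| <= (2 * cnorm a)%:C.
Proof.
move=> fP f1; have := (pf_sa_functional (positive_functional_aut n fP)).2 a.
by rewrite /= aut1 f1 mulr1.
Qed.

Lemma invariant_of_generator f : (forall a, f (Theta 1 a) = f a) ->
  forall n a, f (Theta n a) = f a.
Proof.
move=> f1.
have pos (n : nat) a : f (Theta n%:Z a) = f a.
  elim: n a => [|n IH] a; first by rewrite HT.1.1.
  by rewrite -addn1 PoszD HT.1.2// IH f1.
move=> [n|n] a; first exact: pos.
rewrite NegzE -(pos n.+1) -HT.1.2// addrN HT.1.1//.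
Qed.

Definition average f (k : nat) a : R[i] :=
  (k%:R^-1)%:C * \sum_(j < k) f (Theta j%:Z a).

Lemma average_positive f k :
  positive_functional f -> positive_functional (average f k).
Proof.
move=> fP; split=> [c a b|a ap]; rewrite /average.
  rewrite mulrCA -mulrDr; congr (_ * _); rewrite mulr_sumr -big_split /=.
  by apply: eq_bigr => j _; rewrite autP fP.1.
rewrite mulr_ge0 ?ler0c ?invr_ge0// sumr_ge0// => j _.
exact/fP.2/aut_positive.
Qed.

Lemma average_invariant f (k : nat) a : (forall n a, f (Theta n a) = f a) ->
  (0 < k)%N -> average f k a = f a.
Proof.
move=> finv k0; rewrite /average (eq_bigr (fun=> f a)) => [|j _]; last exact: finv.
rewrite sumr_const card_ord -[f a *+ k]mulr_natl mulrA.
rewrite -(rmorph_nat (real_complex R)) -rmorphM /= mulVf ?mul1r//.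
by rewrite pnatr_eq0 -lt0n.
Qed.

Lemma average1 f k : f 1 = 1 -> (0 < k)%N -> average f k 1 = 1.
Proof.
move=> f1 k0; rewrite -[RHS](average_invariant (f := fun=> 1) (k := k) 1)//.
by rewrite /average; congr (_ * _); apply: eq_bigr => j _; rewrite aut1.
Qed.

(** The two averages telescope, up to their first and last terms. *)
Lemma average_almost_invariant f k a : positive_functional f ->
  complex.Re (f 1) = 1 ->
  `|complex.Re (average f k (Theta 1 a)) - complex.Re (average f k a)|
    <= 4 * cnorm a * k%:R^-1.
Proof.
move=> fP f1.
have tele : \sum_(j < k) f (Theta j%:Z (Theta 1 a)) - \sum_(j < k) f (Theta j%:Z a)
    = f (Theta k%:Z a) - f (Theta 0 a).
  elim: k => [|k IH]; first by rewrite !big_ord0 !subrr.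
  rewrite !big_ord_recr /= opprD addrACA IH -HT.1.2// -PoszD addn1.
  by rewrite addrC subrKA.
rewrite -Re_sub /average -mulrBr tele Re_realM normrM ger0_norm ?invr_ge0//.
rewrite mulrC ler_wpM2r ?invr_ge0//; apply: normc_Re_le.
apply: le_trans (ler_normB _ _) _.
apply: le_trans (lerD (aut_bound _ _ fP f1) (aut_bound _ _ fP f1)) _.
by rewrite -rmorphD lecR; lra.
Qed.

(** A Krylov-Bogoliubov construction in which the state being averaged may vary
    with the length of the average. *)
Lemma invariant_state_limit (U : set_system nat) (f : nat -> A -> R[i]) :
  UltraFilter U -> U --> \oo ->
  (forall n, positive_functional (f n)) -> (forall n, f n 1 = 1) ->
  exists phi : sa_dual A, invariant_states Theta phi /\
    forall a, (fun k => complex.Re (average (f k) k a)) @ U --> complex.Re (phi a).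
Proof.
move=> UU Uoo fP f1.
have avP k : positive_functional (average (f k) k) by exact: average_positive.
have av1 k : complex.Re (average (f k) k 1) <= 1.
  case: k => [|k]; last by rewrite average1.
  by rewrite /average big_ord0 mulr0 ler01.
have [phi [phiP phil]] := ultralimit_functional UU avP av1.
have hR : hausdorff_space R by exact: norm_hausdorff.
have Upos : U [set k | (0 < k)%N] by apply: Uoo; exists 1%N.
have phi1 : phi 1 = 1.
  rewrite (pf1_real phiP); congr (_%:C); apply: (cvg_unique hR (phil 1)).
  apply: cvg_near_cst; apply: filterS Upos => k k0.
  by rewrite average1.
have Reinv a : complex.Re (phi (Theta 1 a)) = complex.Re (phi a).
  apply/eqP; rewrite -subr_eq0; apply/eqP.
  apply: (cvg_unique hR (cvgB (phil (Theta 1 a)) (phil a))).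
  apply/norm_cvg0P.
  apply: (@squeeze_cvgr _ _ _ _ (cst 0) (fun k => 4 * cnorm a * k%:R^-1)).
  - apply: filterS filterT => k _ /=; rewrite normr_ge0 /=.
    by apply: average_almost_invariant => //; rewrite f1.
  - exact: cvg_cst.
  - rewrite -[X in _ --> X](mulr0 (4 * cnorm a)); apply: cvgMr.
    apply: cvg_trans (cvg_app _ Uoo) _.
    rewrite gtr0_cvgV0; first exact: cvgr_idn.
    by exists 1%N => //= n; rewrite ltr0n.
(* Imaginary parts are real parts of values at multiples by [- 'i]. *)
have gen a : phi (Theta 1 a) = phi a.
  apply: complex_eqP; first exact: Reinv.
  have ImE b : complex.Im (phi b) = complex.Re (phi (- 'i *: b)).
    by rewrite (pf_scale phiP) Re_mul /=; ring.
  rewrite !ImE -[RHS]Reinv; congr (complex.Re (phi _)).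
  by rewrite autZ.
exists (sa_mk (pf_sa_dual phiP)); split; last exact: phil.
by split; [split=> //; exact: phiP.2|exact: invariant_of_generator].
Qed.

Lemma invariant_state_positive (psi : sa_dual A) :
  invariant_states Theta psi -> positive_functional psi.
Proof. by move=> [[pos _] _]; split=> //; have [] := sa_dualP psi. Qed.

End ErgodicAverages.

(** * The gauge as a maximum over invariant states *)

Lemma wot_closure_approx (R : realType) (H : hilbertType R) (M : set (H -> H))
    (T : H -> H) (x y : H) (e : R[i]) :
  wot_closure M T -> 0 < e ->
  exists2 S, M S & `|inner (T x) y - inner (S x) y| < e.
Proof.
move=> clT e0.
have nbhsT : nbhs (T : initial_topology (@wot_eval R H))
    [set S : H -> H | `|inner (T x) y - inner (S x) y| < e].
  have /cvg_sup/(_ (x, y)) ev_xy : nbhs (wot_eval T) --> wot_eval T by exact: cvg_id.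
  pose ev (h : {ptws (H * H)%type -> R[i]}) := h (x, y).
  have Ue : nbhs (ev (wot_eval T)) [set z : R[i] | `|inner (T x) y - z| < e].
    by apply/nbhs_normP; exists e.
  have /ev_xy nU := @initial_continuous _ _ ev (wot_eval T) _ Ue.
  exact: (@initial_continuous _ _ (@wot_eval R H) T _ nU).
by have [S [MS eS]] := clT _ nbhsT; exists S.
Qed.

Section Model.
Variables (R : realType) (H : hilbertType R) (M : set (H -> H)).
Variables (rho : (H -> H) -> R[i]) (Xi : int -> (H -> H) -> (H -> H)).
Variables (A : cstarAlgType R) (Theta : int -> A -> A) (iota : A -> H -> H).
Hypothesis HM : wstar_system M rho Xi.
Hypothesis HA : cstar_model M Xi Theta iota.
Hypothesis iota_inj : injective iota.
Implicit Types a : A.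

Let ilin := cm_linear HA.
Let imul := cm_mul HA.
Let istar := cm_star HA.
Let HT := cm_system HA.
Let rhoP := ws_trace HM.

(** A vector of the form [x - iota 1 x] is orthogonal to the range of every
    [iota a], hence, by density, to itself. *)
Lemma model_unital : iota 1 = id.
Proof.
apply/funext => x /=; apply/esym/eqP; rewrite -subr_eq0; apply/eqP.
set y := x - iota 1 x.
have i1y : iota 1 y = 0.
  rewrite /y -[x - _]addrC -scaleN1r (iota_op_linear istar) -repM// mul1r.
  by rewrite scaleN1r addNr.
apply: nsq_eq0; apply/eqP; rewrite eq_le nsq_ge0 andbT.
apply/ler_addgt0Pl => e e0; rewrite addr0.
have ec : 0 < e%:C :> R[i] by rewrite (ltcR 0).
have clid := cm_dense HA (vN_id (ws_vN HM)).
have [_ [a _ <-]] := wot_closure_approx y y clid ec.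
have -> : inner (iota a y) y = 0.
  by rewrite -[a]mul1r (repM imul) istar star1 i1y innerC inner0l conjC0.
rewrite subr0 inner_nsq normc_real ltcR => h.
by rewrite (le_trans (ler_norm _))// ltW.
Qed.

(** On a zero space [id = 0], against [rho id = 1]. *)
Lemma space_nontrivial : exists x : H, x != 0.
Proof.
apply: contrapT => no.
have triv : (id : H -> H) = 0.
  apply/funext => x; apply/eqP; apply: contrapT => /negP x0.
  by apply: no; exists x.
have Mid := vN_id (ws_vN HM).
have := tr_linear rhoP (-1) Mid Mid.
rewrite scaleN1r addNr (tr_unit rhoP) -triv (tr_unit rhoP) mulr1 addNr.
by move/eqP; rewrite oner_eq0.
Qed.

Lemma trace_positive : positive_functional (rho \o iota).
Proof.
split=> [c a b|a ap] /=.
  by rewrite ilin (tr_linear rhoP)//; exact: cm_range HA _.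
apply: (tr_positive rhoP); first exact: cm_range HA _.
by move=> x; apply: (vector_functional_positive ilin imul istar x).2.
Qed.

Definition trace_state : sa_dual A := sa_mk (pf_sa_dual trace_positive).

Lemma trace_state1 : trace_state 1 = 1.
Proof. by rewrite /= model_unital (tr_unit rhoP). Qed.

Lemma trace_state_invariant : invariant_states Theta trace_state.
Proof.
split; first by split; [exact: trace_positive.2|exact: trace_state1].
by move=> n a; rewrite /= -(cm_equivariant HA) (ws_preserving HM)//; exact: cm_range HA _.
Qed.

Lemma trace_state_faithful : faithful_state trace_state.
Proof.
move=> a ap /= ra0; apply/iota_inj.
have -> : iota 0 = 0 by apply/funext => x; rewrite (rep0 ilin).
apply: (tr_faithful rhoP) ra0; first exact: cm_range HA _.
by move=> x; apply: (vector_functional_positive ilin imul istar x).2.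
Qed.

Definition orbit_sum (k : nat) a : A := \sum_(j < k) Theta j%:Z a.

Definition gauge_seq a (k : nat) : R := k%:R^-1 * opnorm (iota (orbit_sum k a)).

Lemma gaugeE a : gauge Xi (iota a) = lim (gauge_seq a @ \oo).
Proof.
rewrite /gauge; congr (lim (_ @ \oo)); apply/funext => k.
rewrite /gauge_seq /orbit_sum; congr (_ * opnorm _).
elim: k => [|k IH].
  by rewrite !big_ord0; apply/funext => x; rewrite (rep0 ilin).
rewrite !big_ord_recr /= IH (cm_equivariant HA).
by apply/funext => x; rewrite (repD ilin).
Qed.

Lemma orbit_sum_positive k a : cpositive a -> cpositive (orbit_sum k a).
Proof.
move=> ap; rewrite /orbit_sum.
apply: (big_ind (@cpositive R A)) => [|b c bp cp|j _].
- by exists 0; rewrite mulr0.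
- apply: (positive_reflect ilin imul istar iota_inj).
    by rewrite starD !cpositive_sa.
  move=> x; rewrite (repD ilin) innerDl Re_add.
  by rewrite addr_ge0// quad_ge0.
- exact: aut_positive.
Qed.

Lemma pf_orbit_sum f k a : positive_functional f ->
  (k%:R^-1)%:C * f (orbit_sum k a) = average Theta f k a.
Proof.
move=> fP; congr (_ * _); apply: (big_morph f (pf_add fP) (pf0 fP)).
Qed.

(** The value of [psi] at the sum of the translates is [k * psi a], and a
    positive element of [A] is at most the operator norm of its image. *)
Lemma invariant_le_gauge_seq (psi : sa_dual A) a k :
  invariant_states Theta psi -> cpositive a -> (0 < k)%N ->
  complex.Re (psi a) <= gauge_seq a k.
Proof.
move=> psiI ap k0; have psiP := invariant_state_positive psiI.
have [[_ psi1] psiinv] := psiI.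
rewrite -(average_invariant a psiinv k0) -(pf_orbit_sum _ _ psiP) Re_realM.
rewrite ler_wpM2l ?invr_ge0//.
have := psiP.2 _ (opnorm_sub_positive ilin imul istar model_unital iota_inj
  (orbit_sum_positive k ap)).
rewrite (pf_sub psiP) (pf_scale psiP) psi1 mulr1.
by rewrite ge0_complex Re_sub => -[_]; rewrite subr_ge0.
Qed.

(** The vectors [x k] lose at most [k.+1^-1] of the norm, so the squeeze
    between the average at [a] and the same plus [k.+1^-1] applies. *)
Lemma gauge_seq_ultralimit (U : set_system nat) a :
  UltraFilter U -> U --> \oo -> cpositive a ->
  exists phi, invariant_states Theta phi /\
    gauge_seq a @ U --> complex.Re (phi a).
Proof.
move=> UU Uoo ap.
have app k : exists x : H, nsq x = 1 /\
    opnorm (iota (orbit_sum k a)) - k.+1%:R^-1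
      < complex.Re (inner (iota (orbit_sum k a) x) x).
  apply: (opnorm_approx ilin imul istar).
  - exact: orbit_sum_positive.
  - by rewrite invr_gt0 ltr0n.
  - exact: space_nontrivial.
have [x hx] := choice app.
pose f k := vector_functional iota (x k).
have fP k : positive_functional (f k) by exact: vector_functional_positive.
have f1 k : f k 1 = 1.
  by rewrite /f vector_functional1 ?(hx k).1//; exact: model_unital.
have [phi [phiI phil]] := invariant_state_limit HT UU Uoo fP f1.
exists phi; split=> //.
have avE k : complex.Re (average Theta (f k) k a)
    = k%:R^-1 * complex.Re (inner (iota (orbit_sum k a) (x k)) (x k)).
  by rewrite -pf_orbit_sum// Re_realM.
have harm : (fun k => complex.Re (average Theta (f k) k a) + k.+1%:R^-1) @ U
    --> complex.Re (phi a).
  rewrite -[X in _ --> X]addr0; apply: cvgD; first exact: phil.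
  by apply: cvg_trans (cvg_app _ Uoo) _; exact: cvg_harmonic.
apply: squeeze_cvgr (phil a) harm.
apply: filterS filterT => k _; rewrite avE /gauge_seq; apply/andP; split.
  rewrite ler_wpM2l ?invr_ge0//.
  have := quad_le_opnorm ilin imul istar model_unital (orbit_sum k a) (x k).
  by rewrite (hx k).1 mulr1.
have [_ lt] := hx k.
have i1 : k%:R^-1 * k.+1%:R^-1 <= k.+1%:R^-1 :> R.
  case: k lt => [|k] _; first by rewrite invr0 mul0r invr_ge0.
  by rewrite ler_piMl ?invr_ge0// invf_le1 ?ltr0n// ler1n.
apply: le_trans (lerD (lexx _) i1).
by rewrite -mulrDr ler_wpM2l ?invr_ge0// -lerBlDr ltW.
Qed.

(** Any two free ultrafilters give the same limit: each limit is the value at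
    [a] of an invariant state, and every such value is below both.  This proves
    the existence of the limit defining the gauge without subadditivity. *)
Lemma gauge_is_max a : cpositive a ->
  exists phi, [/\ invariant_states Theta phi,
    gauge Xi (iota a) = complex.Re (phi a) &
    forall psi, invariant_states Theta psi ->
      complex.Re (psi a) <= gauge Xi (iota a)].
Proof.
move=> ap; have [U0 [UU0 Uoo0]] := ultraFilterLemma eventually_filter.
have ultra_le U psi l : UltraFilter U -> U --> \oo -> invariant_states Theta psi ->
    gauge_seq a @ U --> l -> complex.Re (psi a) <= l.
  move=> UU Uoo psiI sl; rewrite -(cvg_lim _ sl)//.
  apply: limr_ge; first exact: cvgP sl.
  by apply: Uoo; exists 1%N => // k k0; exact: invariant_le_gauge_seq.
have [phi0 [phi0I l0]] := gauge_seq_ultralimit UU0 Uoo0 ap.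
have gE : gauge Xi (iota a) = complex.Re (phi0 a).
  rewrite gaugeE; apply/cvg_lim => //.
  apply: cvg_of_ultra => U UU Uoo.
  have [phi [phiI l]] := gauge_seq_ultralimit UU Uoo ap.
  suff <- : complex.Re (phi a) = complex.Re (phi0 a) by [].
  apply/eqP; rewrite eq_le; apply/andP; split.
    exact: ultra_le l0.
  exact: ultra_le l.
by exists phi0; split=> // psi psiI; rewrite gE; exact: ultra_le l0.
Qed.

End Model.

Theorem theorem2p7 (R : realType) (H : hilbertType R) (M : set (H -> H))
    (rho : (H -> H) -> R[i]) (Xi : int -> (H -> H) -> (H -> H))
    (A : cstarAlgType R) (Theta : int -> A -> A) (iota : A -> H -> H)
    (HM : wstar_system M rho Xi) (HA : cstar_model M Xi Theta iota)
    (iota_faithful : injective iota) :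
  let gauge_eq_trace := forall a : A, cpositive a ->
    (gauge Xi (iota a))%:C = rho (iota a) in
  [/\ uniquely_ergodic Theta <-> strictly_ergodic Theta,
      uniquely_ergodic Theta -> gauge_eq_trace &
      is_simplex (invariant_states Theta) ->
        gauge_eq_trace -> uniquely_ergodic Theta].
Proof.
move=> gauge_eq_trace.
have tauI := trace_state_invariant HM HA.
set tau := trace_state HM HA in tauI.
have tauP := trace_positive HM HA.
have unique_tau : uniquely_ergodic Theta -> invariant_states Theta = [set tau].
  by move=> [f fE]; rewrite fE; move: tauI; rewrite fE => ->.
split.
- split=> [/unique_tau tauE|[f [fE _]]]; last by exists f.
  by exists tau; split=> //; exact: trace_state_faithful.
- move=> /unique_tau tauE a ap.
  have [phi [phiI -> _]] := gauge_is_max HM HA iota_faithful ap.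
  move: phiI; rewrite tauE => ->.
  have /ge0_complex[im0 _] := tauP.2 a ap.
  by apply: complex_eqP => //=; rewrite im0.
- move=> _ gaugeE; exists tau; rewrite eqEsubset; split=> [psi psiI|_ ->//].
  apply: sa_dual_ext; apply: pf_eq => //.
  + exact: invariant_state_positive psiI.
  + by rewrite psiI.1.2 trace_state1.
  + move=> a ap; have [_ [_ _ max]] := gauge_is_max HM HA iota_faithful ap.
    have /ge0_complex[im0 _] := (invariant_state_positive psiI).2 a ap.
    have -> : psi a = (complex.Re (psi a))%:C by exact: complex_eqP.
    by rewrite /= -gaugeE// lecR max.
Qed.
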